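(* Let $d=2$ and let $p$ be a real number with $0 \leq p \leq 9$. Let $c_p^2 : [0,1)^2 \to \mathbb{R}$ be the potential $$c_p^2(t_1,t_2) = \prod_{i=1}^2 \left(1 + \frac p2\left(\frac16 - t_i + t_i^2\right)\right), \qquad (t_1,t_2) \in [0,1)^2,$$ extended $1$-periodically in each coordinate to $\mathbb{R}^2$. Then the $5$-point Fibonacci lattice $$\Phi_5 = \left\{(0, 0), \left(\tfrac15, \tfrac35\right), \left(\tfrac25, \tfrac15\right), \left(\tfrac35, \tfrac45\right), \left(\tfrac45, \tfrac25\right)\right\}$$ minimizes $E_{c_p^2}$ among all $5$-point sets in $[0,1)^2$; that is, $E_{c_p^2}(X) \geq E_{c_p^2}(\Phi_5)$ for every $X \subseteq [0,1)^2$ with $\#X = 5$.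
   Context: The torus is $[0,1)^d$ with opposite faces identified; functions on $[0,1)^d$ are regarded as functions on $\mathbb{R}^d$ that are $1$-periodic in each coordinate. For a function $c : [0,1)^d \to \mathbb{R}$ (extended periodically) and a finite set $X \subseteq [0,1)^d$, the tensor product energy is the sum over ordered pairs of distinct points $$E_c(X) = \sum_{\substack{\mathbf{x}, \mathbf{y} \in X \\ \mathbf{x} \neq \mathbf{y}}} c(\mathbf{x}-\mathbf{y}).$$ A function $c : [0,1)^d \to \mathbb{R}$, extended $1$-periodically in each coordinate to $\mathbb{R}^d$, is called a potential if it is invariant under all permutations of its coordinates and satisfies $c(t_1,t_2,\dots,t_d) = c(1-t_1,t_2,\dots,t_d)$ for all $\mathbf{t} \in [0,1)^d$. *)

(* Defs.v *)
From mathcomp Require Import all_boot all_order all_algebra.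
From mathcomp Require Import finmap.
From mathcomp Require Import reals.

Set Implicit Arguments.
Unset Strict Implicit.
Unset Printing Implicit Defensive.

Import Order.TTheory GRing.Theory Num.Theory.
Local Open Scope ring_scope.

Definition in_unit_cube (R : realType) (d : nat) (x : 'rV[R]_d) : Prop :=
  forall i : 'I_d, 0 <= x 0 i < 1.

Definition frac_part (R : realType) (x : R) : R := x - (Num.floor x)%:~R.

(* A function on [0,1)^d is represented by a total function on R^d of which
   only the values on [0,1)^d matter; [periodize c] is the extension of its
   restriction to [0,1)^d that is 1-periodic in each coordinate. *)
Definition periodize (R : realType) (d : nat) (c : 'rV[R]_d -> R)
    (t : 'rV[R]_d) : R :=
  c (map_mx (@frac_part R) t).

Definition energy (R : realType) (d : nat) (c : 'rV[R]_d -> R)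
    (X : {fset 'rV[R]_d}) : R :=
  \sum_(x <- X) \sum_(y <- X | x != y) periodize c (x - y).

Definition c_pot (R : realType) (d : nat) (p : R) (t : 'rV[R]_d) : R :=
  \prod_(i < d) (1 + p / 2 * (1 / 6 - t 0 i + t 0 i ^+ 2)).

Definition point2 (R : realType) (a b : R) : 'rV[R]_2 :=
  \row_(i < 2) (if i == 0 then a else b).

Definition Phi5 (R : realType) : {fset 'rV[R]_2} :=
  [fset point2 0 0; point2 (1 / 5) (3 / 5); point2 (2 / 5) (1 / 5);
        point2 (3 / 5) (4 / 5); point2 (4 / 5) (2 / 5)]%fset.

(* Main.v *)
Require Import Defs.
From mathcomp Require Import all_boot all_order all_algebra.
From mathcomp Require Import finmap.
From mathcomp Require Import reals.
From mathcomp Require Import ring lra.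

Set Implicit Arguments.
Unset Strict Implicit.
Unset Printing Implicit Defensive.

Import Order.TTheory GRing.Theory Num.Theory.
Local Open Scope ring_scope.

(** The potential is a product k(x) k(y) of one-dimensional factors, and every
    pair of distinct points of the Fibonacci lattice is at distance 1/5 in one
    coordinate and 2/5 in the other.  So the lattice has energy 20 C with
    C = k(1/5) k(2/5), and it is enough to bound the product below by a
    constant plus a function of x plus the same function of y,
      C + F(x) + F(y) <= k(x) k(y),
    where F is a one-dimensional potential whose total energy over any five
    points of the circle is nonnegative ([minorant_le], [minorant_tangent]).

    Nonnegativity of the one-dimensional energy is a convexity argument
    ([pair_sum_ge]).  Among five points on a circle of length 1, the five arcs
    between neighbours have total length 1 and the five arcs between second
    neighbours have total length 2.  If F lies above a line through the point
    (1/5, v) and above a line through the point (2/5, -v), then bounding F by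
    the first line on neighbours and by the second on second neighbours makes
    the slopes cancel, and the values v and -v cancel as well.

    The function F is found as follows.  For p = 9 it is, on [0, 1/2], the
    maximum of two lines, the smallest convex candidate, whose slopes are
    forced by tangency of the two sides at (1/5, 2/5); the inequality becomes
    three polynomial inequalities, one for each unordered pair of lines, and
    each is quadratic in one of the variables, so that it reduces to the sign
    of a quartic in the other.  For general p, with b the Bernoulli polynomial and q = p/2,
      k(x) k(y) = 1 + q (b(x) + b(y)) + q^2 b(x) b(y),
    so k(x) k(y) - C is a nonnegative combination, for 0 <= p <= 9, of the
    same difference at p = 9 and of b(x) + b(y) + 1/15.  The latter is already
    a sum of convex functions of x and of y. *)

(** * Reduction to distances in each coordinate *)

Definition factor (R : realType) (p t : R) : R :=
  1 + p / 2 * (1 / 6 - t + t ^+ 2).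

(** The fractional part of a - b is either |a - b| or 1 - |a - b|, and the
    factor is invariant under t -> 1 - t. *)
Lemma factor_frac_part (R : realType) (p a b : R) :
  0 <= a < 1 -> 0 <= b < 1 -> factor p (frac_part (a - b)) = factor p `|a - b|.
Proof.
move=> /andP[a0 a1] /andP[b0 b1]; rewrite /frac_part.
have [ba|ab] := lerP b a.
  rewrite (@floor_def _ (a - b) 0) ?ger0_norm ?subr_ge0 // ?subr0 //.
  by apply/andP; split => /=; lra.
rewrite (@floor_def _ (a - b) (-1)) ?ltr0_norm ?subr_lt0 //.
  by rewrite /factor mulrN1z; field.
by rewrite mulrN1z; apply/andP; split => /=; lra.
Qed.

Lemma periodize_c_pot (R : realType) (p : R) (x y : 'rV[R]_2) :
  in_unit_cube x -> in_unit_cube y ->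
  periodize (c_pot p) (x - y) =
  factor p `|x 0 0 - y 0 0| * factor p `|x 0 1 - y 0 1|.
Proof.
move=> hx hy; rewrite -!factor_frac_part //.
rewrite /periodize /c_pot big_ord_recl big_ord1 !mxE.
by have -> : lift ord0 ord0 = 1 :> 'I_2 by apply: val_inj.
Qed.

(** Completing the sum with its diagonal turns it into a sum over all pairs,
    which can be transported to the list of coordinates even when different
    points share a coordinate. *)
Lemma sum_distinct (R : realType) (T : choiceType) (X : {fset T})
    (f : T -> T -> R) :
  \sum_(x <- X) \sum_(y <- X | x != y) f x y =
  \sum_(x <- X) \sum_(y <- X) f x y - \sum_(x <- X) f x x.
Proof.
rewrite -sumrB; apply: eq_big_seq => x xX.
rewrite [in RHS](bigD1_seq x) ?fset_uniq //= [RHS]addrC addKr.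
by apply: eq_bigl => y; rewrite eq_sym.
Qed.

Lemma sum_distinct_const (R : realType) (T : choiceType) (X : {fset T})
    (c : R) :
  #|` X| = 5%N -> \sum_(x <- X) \sum_(y <- X | x != y) c = 20 * c.
Proof.
move=> hX; rewrite (sum_distinct X (fun _ _ => c)).
rewrite !big_const_seq !count_predT hX /=.
ring.
Qed.

(** * One-dimensional energies of five points *)

(** What remains of convexity of a symmetric potential on the circle: the
    supporting lines at the two distances 1/5 and 2/5 that occur between five
    equally spaced points.  The slopes are written as decreases. *)
Definition tangent_bounded (R : realType) (v1 s1 v2 s2 : R) (F : R -> R) :=
  forall t, 0 <= t <= 1 ->
  [/\ F (1 - t) = F t, v1 - s1 * (t - 1 / 5) <= F t
    & v2 - s2 * (t - 2 / 5) <= F t].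

(** After sorting the points, the arcs between neighbours are the four
    differences of consecutive points and the arc from the last point through 1
    to the first one; similarly for second neighbours.  Since the arcs of
    each kind have average length 1/5, respectively 2/5, the slopes cancel.
    The term 5 F(0) is the diagonal. *)
Lemma pair_sum_ge (R : realType) (v1 s1 v2 s2 : R) (F : R -> R) (s : seq R) :
  tangent_bounded v1 s1 v2 s2 F ->
  size s = 5%N -> {in s, forall a, 0 <= a < 1} ->
  5 * F 0 + 10 * (v1 + v2) <= \sum_(a <- s) \sum_(b <- s) F `|a - b|.
Proof.
move=> hF sz h01.
have ps : perm_eq (sort <=%R s) s by rewrite perm_sort.
have -> : \sum_(a <- s) \sum_(b <- s) F `|a - b| =
    \sum_(a <- sort <=%R s) \sum_(b <- sort <=%R s) F `|a - b|.
  rewrite [RHS](perm_big _ ps); apply: eq_bigr => a _.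
  by rewrite [RHS](perm_big _ ps).
have := sort_sorted (@le_total _ R) s.
have : size (sort <=%R s) = 5%N by rewrite size_sort.
have : {in sort <=%R s, forall a, 0 <= a < 1}.
  by move=> a; rewrite mem_sort; apply: h01.
case: (sort _ s) => [|a [|b [|c [|d [|e [|]]]]]] //= h _ /and5P[ab bc cd de _].
have ac := le_trans ab bc; have bd := le_trans bc cd; have ce := le_trans cd de.
have ad := le_trans ac cd; have be := le_trans bc ce; have ae := le_trans ab be.
have [ha hb hc hd he] :
    [/\ 0 <= a < 1, 0 <= b < 1, 0 <= c < 1, 0 <= d < 1 & 0 <= e < 1].
  by split; apply: h; rewrite !inE eqxx ?orbT.
have gap u v : 0 <= u < 1 -> 0 <= v < 1 -> u <= v ->
    [/\ F `|u - v| = F (v - u), F `|v - u| = F (v - u), 0 <= v - u <= 1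
      & 0 <= 1 - (v - u) <= 1].
  move=> /andP[u0 u1] /andP[v0 v1'] uv.
  by rewrite distrC ger0_norm ?subr_ge0 //; split => //; apply/andP; split; lra.
have step1 u v : 0 <= u < 1 -> 0 <= v < 1 -> u <= v ->
    2 * (v1 - s1 * (v - u - 1 / 5)) <= F `|u - v| + F `|v - u|.
  move=> hu hv uv; have [-> -> g _] := gap u v hu hv uv.
  by have [_ ? _] := hF _ g; lra.
have step2 u v : 0 <= u < 1 -> 0 <= v < 1 -> u <= v ->
    2 * (v2 - s2 * (v - u - 2 / 5)) <= F `|u - v| + F `|v - u|.
  move=> hu hv uv; have [-> -> g _] := gap u v hu hv uv.
  by have [_ _ ?] := hF _ g; lra.
have wrap1 u v : 0 <= u < 1 -> 0 <= v < 1 -> u <= v ->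
    2 * (v1 - s1 * (1 - (v - u) - 1 / 5)) <= F `|u - v| + F `|v - u|.
  move=> hu hv uv; have [-> -> g g'] := gap u v hu hv uv.
  by have [e1 _ _] := hF _ g; have [_ ? _] := hF _ g'; lra.
have wrap2 u v : 0 <= u < 1 -> 0 <= v < 1 -> u <= v ->
    2 * (v2 - s2 * (1 - (v - u) - 2 / 5)) <= F `|u - v| + F `|v - u|.
  move=> hu hv uv; have [-> -> g g'] := gap u v hu hv uv.
  by have [e1 _ _] := hF _ g; have [_ _ ?] := hF _ g'; lra.
rewrite !big_cons !big_nil !subrr !normr0.
move: (step1 _ _ ha hb ab) (step1 _ _ hb hc bc) (step1 _ _ hc hd cd)
  (step1 _ _ hd he de) (wrap1 _ _ ha he ae) (step2 _ _ ha hc ac)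
  (step2 _ _ hb hd bd) (step2 _ _ hc he ce) (wrap2 _ _ ha hd ad)
  (wrap2 _ _ hb he be).
clear; lra.
Qed.

(** * The potential at p = 9 *)

Lemma linear_le_quadratic (R : realFieldType) (a b c t : R) :
  0 < a -> b ^+ 2 <= 4 * a * c -> b * t <= a * t ^+ 2 + c.
Proof.
move=> a0 hd; rewrite -subr_ge0.
have -> : a * t ^+ 2 + c - b * t =
    ((2 * a * t - b) ^+ 2 + (4 * a * c - b ^+ 2)) / (4 * a).
  by field; rewrite gt_eqF.
apply: divr_ge0; last by lra.
by apply: addr_ge0; rewrite ?sqr_ge0 ?subr_ge0.
Qed.

(** The factor for p = 9 in the variable s = 1/2 - t, which makes it even. *)
Definition centered_factor (R : realType) (s : R) : R := 5 / 8 + 9 / 2 * s ^+ 2.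

(** The difference of the two sides is a quadratic in t with positive leading
    coefficient; the hypothesis says that its discriminant is not positive. *)
Lemma affine_le_product (R : realType) (m sigma tau s t : R) :
  tau ^+ 2 <= 18 * centered_factor s *
    (5 / 8 * centered_factor s - m - sigma * s) ->
  m + sigma * s + tau * t <= centered_factor s * centered_factor t.
Proof.
move=> h; have s2 := sqr_ge0 s.
have K0 : 0 < 9 / 2 * centered_factor s by rewrite /centered_factor; lra.
have := @linear_le_quadratic R _ tau
  (5 / 8 * centered_factor s - m - sigma * s) t K0.
have -> : 4 * (9 / 2 * centered_factor s) = 18 * centered_factor s by field.
move=> /(_ h); rewrite [centered_factor t]/centered_factor; lra.
Qed.

(** Lines through the distances 1/5 (s = 3/10) and 2/5 (s = 1/10).  The slopes
    1809/1000 and 927/1000 are the partial derivatives of k(s) k(t) at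
    (3/10, 1/10), where k(s) k(t) = 6901/10000.  The values at the two distances
    must be opposite; 14/100 is a choice inside the range that
    [inner_lines_le] and [outer_lines_le] allow. *)
Definition inner_line (R : realType) (s : R) : R :=
  14 / 100 + 1809 / 1000 * (s - 3 / 10).
Definition outer_line (R : realType) (s : R) : R :=
  - (14 / 100) + 927 / 1000 * (s - 1 / 10).

(** Both sides agree to first order at (3/10, 1/10), so the quartic of the
    discriminant condition has a double root at s = 3/10; the cofactor is a
    positive quadratic. *)
Lemma mixed_lines_le (R : realType) (s t : R) :
  6901 / 10000 + (inner_line s + outer_line t)
  <= centered_factor s * centered_factor t.
Proof.
apply: le_trans
  (@affine_le_product R (547 / 10000) (1809 / 1000) (927 / 1000) s t _).
  by rewrite /inner_line /outer_line; lra.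
rewrite -subr_ge0 [X in 0 <= X](_ : _ = (s - 3 / 10) ^+ 2 *
   (3645 / 16 * (s - 27 / 1250) ^+ 2
     + (32 + 44 / 100 + 101 / 200 ^+ 2 - 3645 / 16 * (27 / 1250) ^+ 2))).
  apply: mulr_ge0; first exact: sqr_ge0.
  by have := sqr_ge0 (s - 27 / 1250); lra.
by rewrite /centered_factor; field.
Qed.

(** Unlike the mixed case this one is strict.  The first square absorbs the two
    leading terms of the quartic of the discriminant condition, and a positive
    quadratic remains. *)
Lemma inner_lines_le (R : realType) (s t : R) :
  6901 / 10000 + (inner_line s + inner_line t)
  <= centered_factor s * centered_factor t.
Proof.
apply: le_trans
  (@affine_le_product R (- (1153 / 10000)) (1809 / 1000) (1809 / 1000) s t _).
  by rewrite /inner_line; lra.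
rewrite /centered_factor.
have := sqr_ge0 (s * (s - 201 / 625)).
have := sqr_ge0 (s - 21 / 100).
have := sqr_ge0 s.
lra.
Qed.

Lemma outer_lines_le (R : realType) (s t : R) :
  6901 / 10000 + (outer_line s + outer_line t)
  <= centered_factor s * centered_factor t.
Proof.
apply: le_trans
  (@affine_le_product R (2247 / 10000) (927 / 1000) (927 / 1000) s t _).
  by rewrite /outer_line; lra.
rewrite /centered_factor.
have := sqr_ge0 (s * (s - 103 / 625)).
have := sqr_ge0 (s - 14 / 100).
have := sqr_ge0 s.
lra.
Qed.

Definition envelope (R : realType) (t : R) : R :=
  Num.max (inner_line `|1 / 2 - t|) (outer_line `|1 / 2 - t|).

(** Each of the four ways in which the two maxima are attained is one of the
    bounds above, up to exchanging the variables. *)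
Lemma envelope_le_factor9 (R : realType) (x y : R) :
  6901 / 10000 + (envelope x + envelope y) <= factor 9 x * factor 9 y.
Proof.
have E z : factor 9 z = centered_factor `|1 / 2 - z|.
  by rewrite /centered_factor real_normK ?num_real // /factor; field.
rewrite !E /envelope; set s := `|1 / 2 - x|; set t := `|1 / 2 - y|.
have i1 := inner_lines_le s t; have i2 := outer_lines_le s t.
have i3 := mixed_lines_le s t; have := mixed_lines_le t s.
rewrite [inner_line t + _]addrC [X in _ <= X]mulrC => i4.
by rewrite /Num.max; case: ifP => _; case: ifP.
Qed.

Lemma envelope_tangent (R : realType) :
  tangent_bounded (14 / 100) (1809 / 1000)
    (- (14 / 100)) (927 / 1000) (@envelope R).
Proof.
move=> t _; have ht := ler_norm (1 / 2 - t); split.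
- rewrite /envelope.
  by have -> : 1 / 2 - (1 - t) = - (1 / 2 - t) by [field]; rewrite normrN.
- by rewrite /envelope le_max /inner_line; apply/orP; left; lra.
- by rewrite /envelope le_max /outer_line; apply/orP; right; lra.
Qed.

(** * The potential for 0 <= p <= 9 *)

Definition bernoulli (R : realType) (t : R) : R := 1 / 6 - t + t ^+ 2.

(** The shift 1/30 makes the values of the Bernoulli polynomial at 1/5 and 2/5,
    namely 1/150 and -11/150, opposite to each other. *)
Definition minorant (R : realType) (p t : R) : R :=
  (p / 2 * (1 - p / 9)) * (bernoulli t + 1 / 30) + (p / 9) ^+ 2 * envelope t.

(** With q = p/2, the product at p minus its value at (1/5, 2/5) equals
    q (1 - p/9) (b(x) + b(y) + 1/15) plus (p/9)^2 times the same difference at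
    p = 9, so only the second part is an inequality. *)
Lemma minorant_le (R : realType) (p x y : R) :
  factor p (1 / 5) * factor p (2 / 5) + (minorant p x + minorant p y)
  <= factor p x * factor p y.
Proof.
have h := ler_wpM2l (sqr_ge0 (p / 9)) (envelope_le_factor9 x y).
move: h; rewrite /minorant /bernoulli /factor; lra.
Qed.

(** Both parts of the minorant lie above their lines, and their coefficients
    are nonnegative exactly because 0 <= p <= 9. *)
Lemma minorant_tangent (R : realType) (p : R) : 0 <= p <= 9 ->
  let u := p / 2 * (1 - p / 9) in
  let w := (p / 9) ^+ 2 in
  let v := u * (1 / 25) + w * (14 / 100) in
  tangent_bounded v (u * (3 / 5) + w * (1809 / 1000))
    (- v) (u * (1 / 5) + w * (927 / 1000)) (minorant p).
Proof.
move=> /andP[p0 p9] u w v t t01; rewrite /v /minorant -/u -/w.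
have hu : 0 <= u by apply: mulr_ge0; lra.
have hw : 0 <= w := sqr_ge0 (p / 9).
clearbody u w; clear v.
have [-> e1 e2] := envelope_tangent t01.
have b1 : 1 / 25 - 3 / 5 * (t - 1 / 5) <= bernoulli t + 1 / 30.
  by rewrite /bernoulli; have := sqr_ge0 (t - 1 / 5); lra.
have b2 : - (1 / 25) - 1 / 5 * (t - 2 / 5) <= bernoulli t + 1 / 30.
  by rewrite /bernoulli; have := sqr_ge0 (t - 2 / 5); lra.
split.
- by rewrite /bernoulli; field.
- by have := ler_wpM2l hu b1; have := ler_wpM2l hw e1; lra.
- by have := ler_wpM2l hu b2; have := ler_wpM2l hw e2; lra.
Qed.

(** * Energies of five-point sets *)

(** Each coordinate contributes a nonnegative one-dimensional energy, because
    the two supporting values of the minorant are opposite. *)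
Lemma energy_ge (R : realType) (p : R) (X : {fset 'rV[R]_2}) :
  0 <= p <= 9 -> (forall x, x \in X -> in_unit_cube x) -> #|` X| = 5%N ->
  20 * (factor p (1 / 5) * factor p (2 / 5)) <= energy (c_pot p) X.
Proof.
move=> hp hX h5.
have coord_ge0 (i : 'I_2) :
    0 <= \sum_(x <- X) \sum_(y <- X | x != y) minorant p `|x 0 i - y 0 i|.
  rewrite sum_distinct subr_ge0.
  under eq_bigr do rewrite subrr normr0.
  rewrite big_const_seq count_predT h5.
  have := @pair_sum_ge R _ _ _ _ _ [seq x 0 i | x : 'rV[R]_2 <- X]
    (minorant_tangent hp).
  rewrite size_map => /(_ h5) H.
  apply: le_trans (le_trans (H _) _).
  - by rewrite /=; lra.
  - by move=> _ /mapP[x xX ->]; apply: hX.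
  - by rewrite big_map; apply: ler_sum => x _; rewrite big_map.
have h0 := coord_ge0 0; have h1 := coord_ge0 1.
rewrite -(sum_distinct_const _ h5).
apply: (@le_trans _ _ (\sum_(x <- X) \sum_(y <- X | x != y)
  (factor p (1 / 5) * factor p (2 / 5) +
   (minorant p `|x 0 0 - y 0 0| + minorant p `|x 0 1 - y 0 1|)))).
  under [X in _ <= X]eq_bigr do rewrite big_split /= big_split /=.
  by rewrite big_split /= big_split /= lerDl addr_ge0.
rewrite /energy big_seq [X in _ <= X]big_seq; apply: ler_sum => x xX.
rewrite big_seq_cond [X in _ <= X]big_seq_cond; apply: ler_sum => y /andP[yX _].
by rewrite periodize_c_pot ?minorant_le //; apply: hX.
Qed.

Lemma point2E (R : realType) (a b : R) :
  (point2 a b 0 0 = a) * (point2 a b 0 1 = b).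
Proof. by rewrite /point2 !mxE. Qed.

Lemma point2_inj (R : realType) (a b c d : R) :
  (point2 a b == point2 c d) = (a == c) && (b == d).
Proof.
apply/eqP/andP => [e|[/eqP-> /eqP->] //].
have := (congr1 (fun z : 'rV__ => z 0 0) e, congr1 (fun z : 'rV__ => z 0 1) e).
by rewrite !point2E => -[-> ->].
Qed.

Lemma card_Phi5 (R : realType) : #|` Phi5 R| = 5%N.
Proof.
have ne (a b c d : R) : a < c -> (point2 c d == point2 a b) = false.
  by move=> ac; rewrite point2_inj gt_eqF.
rewrite /Phi5.
do 4![rewrite fsetUC cardfsU1 !inE !ne;
  try match goal with |- is_true (_ < _) => lra end].
by rewrite cardfs1.
Qed.

Lemma Phi5_in_unit_cube (R : realType) (x : 'rV[R]_2) :
  x \in Phi5 R -> in_unit_cube x.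
Proof.
rewrite /Phi5 !inE -!orbA => /or4P[|||/orP[|]] /eqP-> i; rewrite mxE;
  by case: ifP => _; lra.
Qed.

Lemma factor_distances (R : realType) (p z : R) :
  (z = 1 / 5 \/ z = - (1 / 5) \/ z = 4 / 5 \/ z = - (4 / 5) ->
    factor p `|z| = factor p (1 / 5)) /\
  (z = 2 / 5 \/ z = - (2 / 5) \/ z = 3 / 5 \/ z = - (3 / 5) ->
    factor p `|z| = factor p (2 / 5)).
Proof.
split; move=> [|[|[|]]] ->; rewrite ?normrN ger0_norm ?divr_ge0 // /factor;
  by field.
Qed.

(** The multiples of (1/5, 3/5) modulo 1 have coordinate distances 1/5 and 2/5
    in one order or the other. *)
Lemma Phi5_distances (R : realType) (p : R) (x y : 'rV[R]_2) :
  x \in Phi5 R -> y \in Phi5 R -> x != y ->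
  factor p `|x 0 0 - y 0 0| * factor p `|x 0 1 - y 0 1|
  = factor p (1 / 5) * factor p (2 / 5).
Proof.
(* Ordering the first coordinates halves the number of cases below. *)
wlog xy : x y / x 0 0 <= y 0 0.
  move=> H hx hy xy; case/orP: (le_total (x 0 0) (y 0 0)) => le; first exact: H.
  rewrite distrC (distrC (x 0 1)); apply: H => //.
  by rewrite eq_sym.
move: xy; rewrite /Phi5 !inE -!orbA => xy.
have near z := proj1 (factor_distances p z).
have far z := proj2 (factor_distances p z).
move=> /or4P[|||/orP[|]] /eqP xE /or4P[|||/orP[|]] /eqP yE; move: xy;
  rewrite xE yE ?eqxx // !point2E => xy _; first [lra
  | by rewrite near ?far //; lra
  | by rewrite far ?near 1?mulrC //; lra].
Qed.

Lemma energy_Phi5 (R : realType) (p : R) :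
  energy (c_pot p) (Phi5 R) = 20 * (factor p (1 / 5) * factor p (2 / 5)).
Proof.
rewrite -(sum_distinct_const _ (card_Phi5 R)) /energy.
rewrite big_seq [RHS]big_seq; apply: eq_bigr => x xX.
rewrite big_seq_cond [RHS]big_seq_cond; apply: eq_bigr => y /andP[yX xy].
by rewrite periodize_c_pot ?Phi5_distances //; apply: Phi5_in_unit_cube.
Qed.

Theorem theorem2 (R : realType) (p : R) (hp : 0 <= p <= 9)
    (X : {fset 'rV[R]_2})
    (hXcube : forall x : 'rV[R]_2, x \in X -> in_unit_cube x)
    (hXcard : #|` X| = 5%N) :
  energy (c_pot p) (Phi5 R) <= energy (c_pot p) X.
Proof. by rewrite energy_Phi5; apply: energy_ge. Qed.
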